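(* Let $f$ be a differentiable function on $[-1,1]$ with bounded first derivative, let $\tau\in(-1,1)$, $g(x)=\dfrac{f(x)-f(\tau)}{x-\tau}$ for $x\in[-1,1]$, $x\ne\tau$, and $D_{1,f}=\max_{|x|\le1}|f'(x)|$. Let $g^{[\varepsilon]}(x)$ denote the value of $g$ at $x$ computed in floating point arithmetic of precision $\varepsilon$ (see context). If $x\in[-1,1]$ and $|x-\tau|\ge 16\varepsilon$, then $$\big|g^{[\varepsilon]}(x)-g(x)\big|\;\lesssim\;\frac{8\,\varepsilon\,D_{1,f}}{|x-\tau|}.$$
   Context: Notation: $a\approx b$ means $a=b\,(1+O(\varepsilon))$, and $a\lesssim b$ means $a<b$ or $a\approx b$; here $O(\varepsilon)$ is as $\varepsilon\to0^+$, uniformly in all other quantities. $D_{1,f}$ is the maximum (supremum) of $|f'|$ on $[-1,1]$, assumed finite. Floating point model: the values of $f$ are assumed to be computed exactly, but $x$ and $\tau$ need not be exactly representable. The computed value is $$g^{[\varepsilon]}(x)=\frac{f(x(1+\gamma_1))-f(\tau(1+\gamma_2))}{\big(x(1+\gamma_1)-\tau(1+\gamma_2)\big)(1+\gamma_3)},$$ where $\gamma_1,\gamma_2,\gamma_3$ are arbitrary real numbers (possibly depending on $x$, $\tau$, $\varepsilon$) with $|\gamma_1|,|\gamma_2|\le\varepsilon$ and $|\gamma_3|\lesssim2\varepsilon$. The perturbed arguments at which $f$ is evaluated are understood to lie in the domain $[-1,1]$ of $f$. *)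

(* Defs.v *)
From Stdlib Require Export Reals.
Open Scope R_scope.

Definition I11 (x : R) : Prop := -1 <= x <= 1.

(* [D_in] only constrains difference quotients taken inside [I11], so the
   derivative is one-sided at -1 and 1, and the values of [f] outside [-1,1]
   are irrelevant. *)
Definition has_derivative_on_I11 (f f' : R -> R) : Prop :=
  forall x : R, I11 x -> D_in f f' I11 x.

(* [D] is D_{1,f}, given the derivative [f'] of [f]. A finite least upper bound
   exists exactly when f' is bounded on [-1,1]. *)
Definition is_D1 (f' : R -> R) (D : R) : Prop :=
  is_lub (fun y : R => exists x : R, I11 x /\ y = Rabs (f' x)) D.

(* a = b (1 + O(eps)) and its one-sided version, with the constant [K] implied
   by O(eps) made explicit: uniformity of O(eps) means that one [K] and one
   range 0 < eps < eps0 serve all the other quantities at once, so [K] and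
   [eps0] must be quantified outside those quantities. *)
Definition approx (K eps a b : R) : Prop :=
  exists delta : R, Rabs delta <= K * eps /\ a = b * (1 + delta).

Definition lesssim (K eps a b : R) : Prop :=
  a < b \/ approx K eps a b.

Definition g (f : R -> R) (tau x : R) : R := (f x - f tau) / (x - tau).

Definition g_fl (f : R -> R) (tau x gamma1 gamma2 gamma3 : R) : R :=
  (f (x * (1 + gamma1)) - f (tau * (1 + gamma2))) /
  ((x * (1 + gamma1) - tau * (1 + gamma2)) * (1 + gamma3)).

(* Main.v *)
Require Import Defs.
From Stdlib Require Import Reals.
From Stdlib Require Import Lra Psatz.
From Coquelicot Require Import Coquelicot.
Open Scope R_scope.

(** Write [d = x - tau], and let [d'] be the difference of the perturbed
    arguments and [N], [N'] the exact and perturbed numerators, so that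
    [g = N / d] and [g_fl = (N' / d') / (1 + gamma3)].  By the mean value
    theorem [f] is [D]-Lipschitz on [-1,1] ([lipschitz_of_derivative_bound]).
    Since both arguments have modulus at most 1, [N'] differs from [N] by at
    most [2 eps D] and [d'] from [d] by at most [2 eps]; moreover
    [|N' / d'| <= D].  Two errors add up.

    - Perturbing the arguments: [N'/d' - N/d = (N' - N)/d - (N'/d') (d' - d)/d]
      is at most [4 eps D / |d|] ([quotient_perturbation]).
    - Rounding the result: dividing by [1 + gamma3] costs at most
      [D |gamma3| / |1 + gamma3|], which is [2 eps D (1 + O(eps))]
      ([relative_rounding_error]); as [|d| <= 2] this is at most
      [(4 eps D / |d|) (1 + O(eps))].

    The sum is [(8 eps D / |d|) (1 + O(eps))].  The separation
    [|d| >= 16 eps] exceeds the bound [2 eps] on [|d' - d|], which keeps [d']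
    away from zero. *)

(** * The mean value inequality on [-1,1] with one-sided derivatives *)

Definition clamp (t : R) : R := Rmax (-1) (Rmin 1 t).

Lemma clamp_in (t : R) : I11 (clamp t).
Proof.
  unfold I11, clamp, Rmax, Rmin.
  destruct (Rle_dec 1 t); destruct (Rle_dec (-1) _); lra.
Qed.

Lemma clamp_id (t : R) : I11 t -> clamp t = t.
Proof.
  unfold I11, clamp, Rmax, Rmin; intros H.
  destruct (Rle_dec 1 t); destruct (Rle_dec (-1) _); lra.
Qed.

(** Precomposing with [clamp] extends [f] continuously from [-1,1] to the line,
    which turns continuity relative to [-1,1] into the two-sided continuity at
    the endpoints that the mean value theorem asks for. *)
Lemma continuity_clamp (f f' : R -> R) (c : R) :
  has_derivative_on_I11 f f' -> I11 c ->
  continuity_pt (fun t => f (clamp t)) c.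
Proof.
  intros Hf Hc e He.
  destruct (cont_deriv _ _ _ _ (Hf c Hc) e He) as [a [Ha Hlim]].
  exists a; split; [exact Ha | intros t [_ Ht]].
  cbn in *; unfold Rdist in *.
  rewrite (clamp_id c Hc).
  destruct (Req_dec c (clamp t)) as [<- | Hne].
  { rewrite Rminus_diag, Rabs_R0; exact He. }
  apply Hlim; split.
  - split; [apply clamp_in | exact Hne].
  - apply Rle_lt_trans with (2 := Ht).
    unfold I11, clamp, Rmax, Rmin in *.
    destruct (Rle_dec 1 t); destruct (Rle_dec (-1) _);
      unfold Rabs; repeat destruct Rcase_abs; lra.
Qed.

Lemma derivable_clamp (f f' : R -> R) (c : R) :
  has_derivative_on_I11 f f' -> -1 < c < 1 ->
  derivable_pt_lim (fun t => f (clamp t)) c (f' c).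
Proof.
  intros Hf Hc e He.
  assert (Ic : I11 c) by (unfold I11; lra).
  destruct (Hf c Ic e He) as [a [Ha Hlim]].
  assert (Hd : 0 < Rmin a (Rmin (1 - c) (c + 1)))
    by (repeat apply Rmin_pos; lra).
  exists (mkposreal _ Hd); intros k Hk0 Hk; cbn in *.
  pose proof (Rmin_l a (Rmin (1 - c) (c + 1))).
  pose proof (Rmin_r a (Rmin (1 - c) (c + 1))).
  pose proof (Rmin_l (1 - c) (c + 1)).
  pose proof (Rmin_r (1 - c) (c + 1)).
  assert (Ick : I11 (c + k))
    by (unfold I11; revert Hk; unfold Rabs; destruct Rcase_abs; lra).
  rewrite (clamp_id c Ic), (clamp_id _ Ick).
  specialize (Hlim (c + k)); unfold Rdist in Hlim.
  replace (c + k - c) with k in Hlim by ring.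
  apply Hlim; repeat split; try apply Ick; lra.
Qed.

Lemma lipschitz_of_derivative_bound (f f' : R -> R) (D a b : R) :
  has_derivative_on_I11 f f' ->
  (forall c, I11 c -> Rabs (f' c) <= D) ->
  I11 a -> I11 b ->
  Rabs (f b - f a) <= D * Rabs (b - a).
Proof.
  intros Hf HD Ha Hb.
  assert (Hmin : -1 <= Rmin a b) by (apply Rmin_glb; [apply Ha | apply Hb]).
  assert (Hmax : Rmax a b <= 1) by (apply Rmax_lub; [apply Ha | apply Hb]).
  destruct (MVT_gen (fun t => f (clamp t)) a b f') as [c [Hc Heq]].
  - intros t Ht; apply is_derive_Reals, derivable_clamp; [exact Hf | lra].
  - intros t Ht; apply (continuity_clamp f f'); [exact Hf | unfold I11; lra].
  - rewrite (clamp_id a Ha), (clamp_id b Hb) in Heq.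
    rewrite Heq, Rabs_mult.
    apply Rmult_le_compat_r; [apply Rabs_pos | apply HD; unfold I11; lra].
Qed.

(** * Error estimates *)

Lemma perturbation_le (y gam eps : R) :
  I11 y -> Rabs gam <= eps -> Rabs (y * (1 + gam) - y) <= eps.
Proof.
  intros Hy Hg.
  replace (y * (1 + gam) - y) with (y * gam) by ring.
  rewrite Rabs_mult.
  assert (Rabs y <= 1) by (apply Rabs_le; exact Hy).
  pose proof (Rabs_pos y); pose proof (Rabs_pos gam); nra.
Qed.

(** The change of the denominator is weighted by the perturbed quotient
    [N' / d'], which [D] bounds, so no second-order term appears. *)
Lemma quotient_perturbation (N N' d d' D eta : R) :
  d <> 0 -> d' <> 0 ->
  Rabs (N' - N) <= D * eta ->
  Rabs (d' - d) <= eta ->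
  Rabs (N' / d') <= D ->
  Rabs (N' / d' - N / d) <= 2 * eta * D / Rabs d.
Proof.
  intros Hd Hd' HN Hdd HD.
  replace (N' / d' - N / d) with (((N' - N) - N' / d' * (d' - d)) / d)
    by (field; split; assumption).
  rewrite Rabs_div by exact Hd.
  apply Rmult_le_compat_r.
  { left; apply Rinv_0_lt_compat, Rabs_pos_lt, Hd. }
  unfold Rminus at 1.
  eapply Rle_trans; [apply Rabs_triang |].
  rewrite Rabs_Ropp, Rabs_mult.
  pose proof (Rabs_pos (N' / d')); pose proof (Rabs_pos (d' - d)).
  nra.
Qed.

Lemma lesssim_le (K eps a b : R) :
  0 < eps -> 0 <= b -> lesssim K eps a b -> a <= b * (1 + Rabs K * eps).
Proof.
  intros He Hb [H | [delta [Hd ->]]].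
  - pose proof (Rabs_pos K).
    assert (0 <= b * (Rabs K * eps)) by (repeat apply Rmult_le_pos; lra).
    lra.
  - apply Rmult_le_compat_l; [exact Hb |].
    pose proof (Rle_abs delta); pose proof (Rle_abs K); nra.
Qed.

(** When [b = 0] the bound forces [a = 0], and any [delta] will do. *)
Lemma le_lesssim (C eps a b : R) :
  0 <= C -> 0 < eps -> 0 <= a -> 0 <= b ->
  a <= b * (1 + C * eps) -> lesssim C eps a b.
Proof.
  intros HC He Ha Hb H.
  assert (0 <= C * eps) by (apply Rmult_le_pos; lra).
  destruct (Rlt_le_dec a b) as [Hlt | Hle]; [left; exact Hlt | right].
  destruct (Req_dec b 0) as [-> | Hb0].
  - exists 0; split; [rewrite Rabs_R0; lra | lra].
  - exists (a / b - 1); split; [| field; exact Hb0].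
    assert (1 <= a / b <= 1 + C * eps).
    { split; [apply Rle_div_r | apply Rle_div_l]; lra. }
    rewrite Rabs_pos_eq; lra.
Qed.

(** With [t = 2 eps (1 + M eps)] and [t <= 1/2], [1 / (1 - t) <= 1 + 2 t], and
    [(1 + M eps) (1 + 2 t) <= 1 + (M + 6) eps] because [M eps <= 1/8]. *)
Lemma relative_rounding_error (M eps q gam : R) :
  0 <= M -> 0 < eps -> eps * (8 * (1 + M)) < 1 ->
  Rabs gam <= 2 * eps * (1 + M * eps) ->
  1 + gam <> 0 /\
  Rabs (q / (1 + gam) - q) <= Rabs q * (2 * eps * (1 + (M + 6) * eps)).
Proof.
  intros HM He Hs Hg.
  assert (HMe : 0 <= M * eps <= 1 / 8) by nra.
  set (u := 1 + M * eps) in *.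
  assert (Hu : 1 <= u <= 9 / 8) by (unfold u; lra).
  assert (Ht : 0 <= 2 * eps * u <= 1 / 2) by nra.
  assert (H1 : 0 < 1 + gam)
    by (revert Hg; unfold Rabs; destruct Rcase_abs; lra).
  split; [lra |].
  replace (q / (1 + gam) - q) with (- (q * (gam / (1 + gam)))) by (field; lra).
  rewrite Rabs_Ropp, Rabs_mult, Rabs_div by lra.
  apply Rmult_le_compat_l; [apply Rabs_pos |].
  rewrite (Rabs_pos_eq (1 + gam)) by lra.
  assert (Hlow : 1 - 2 * eps * u <= 1 + gam)
    by (revert Hg; unfold Rabs; destruct Rcase_abs; lra).
  apply Rle_div_l; [lra |].
  assert (Hsq : u * u <= 3 / 2) by nra.
  assert (Hc : u * (1 + 4 * eps * u) <= 1 + (M + 6) * eps)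
    by (unfold u in *; nra).
  set (w := 1 + (M + 6) * eps) in *.
  assert (0 <= u * (1 + 4 * eps * u)) by nra.
  assert (Hw : u <= w * (1 - 2 * eps * u)).
  { apply Rle_trans with (u * (1 + 4 * eps * u) * (1 - 2 * eps * u)).
    - assert (0 <= u * (2 * eps * u) * (1 - 2 * (2 * eps * u)))
        by (repeat apply Rmult_le_pos; lra).
      lra.
    - apply Rmult_le_compat_r; lra. }
  assert (w * (1 - 2 * eps * u) <= w * (1 + gam))
    by (apply Rmult_le_compat_l; lra).
  apply Rle_trans with (1 := Hg).
  rewrite (Rmult_assoc (2 * eps)).
  apply Rmult_le_compat_l; lra.
Qed.

Theorem lemma2 :
  forall K : R,
  exists C eps0 : R, 0 < eps0 /\
  forall eps : R, 0 < eps < eps0 ->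
  forall (f f' : R -> R) (D tau x gamma1 gamma2 gamma3 : R),
    has_derivative_on_I11 f f' ->
    is_D1 f' D ->
    -1 < tau < 1 ->
    I11 x ->
    16 * eps <= Rabs (x - tau) ->
    Rabs gamma1 <= eps ->
    Rabs gamma2 <= eps ->
    lesssim K eps (Rabs gamma3) (2 * eps) ->
    I11 (x * (1 + gamma1)) ->
    I11 (tau * (1 + gamma2)) ->
    lesssim C eps
      (Rabs (g_fl f tau x gamma1 gamma2 gamma3 - g f tau x))
      (8 * eps * D / Rabs (x - tau)).
Proof.
  intros K.
  pose proof (Rabs_pos K) as HK.
  exists (Rabs K + 6), (/ (8 * (1 + Rabs K))).
  assert (Hpos : 0 < 8 * (1 + Rabs K)) by lra.
  split; [apply Rinv_0_lt_compat; exact Hpos |].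
  intros eps [He He0] f f' D tau x g1 g2 g3 Hf [HD _] Htau Hx Hsep Hg1 Hg2 Hg3
    Hx' Htau'.
  assert (Hs : eps * (8 * (1 + Rabs K)) < 1).
  { apply (Rmult_lt_compat_r _ _ _ Hpos) in He0.
    rewrite Rinv_l in He0 by lra; exact He0. }
  assert (Hbd : forall c, I11 c -> Rabs (f' c) <= D)
    by (intros c Hc; apply HD; exists c; split; [exact Hc | reflexivity]).
  assert (HD0 : 0 <= D)
    by (apply Rle_trans with (2 := Hbd x Hx); apply Rabs_pos).
  assert (Itau : I11 tau) by (unfold I11; lra).
  apply lesssim_le in Hg3; [| exact He | lra].
  pose proof (perturbation_le x g1 eps Hx Hg1) as Hpx.
  pose proof (perturbation_le tau g2 eps Itau Hg2) as Hpt.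
  unfold g_fl, g.
  set (x' := x * (1 + g1)) in *; set (tau' := tau * (1 + g2)) in *.
  clearbody x' tau'.
  assert (Hd : 0 < Rabs (x - tau) <= 2)
    by (split; [lra |]; apply Rabs_le; unfold I11 in Hx; lra).
  assert (Hdd : Rabs ((x' - tau') - (x - tau)) <= 2 * eps).
  { replace ((x' - tau') - (x - tau)) with ((x' - x) + - (tau' - tau)) by ring.
    eapply Rle_trans; [apply Rabs_triang |]; rewrite Rabs_Ropp; lra. }
  assert (Hd0 : x - tau <> 0) by (intros E; rewrite E, Rabs_R0 in Hd; lra).
  assert (Hd0' : x' - tau' <> 0).
  { intros E; rewrite E in Hdd.
    unfold Rminus at 1 in Hdd; rewrite Rplus_0_l, Rabs_Ropp in Hdd; lra. }
  assert (HN : Rabs ((f x' - f tau') - (f x - f tau)) <= D * (2 * eps)).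
  { pose proof (lipschitz_of_derivative_bound f f' D _ _ Hf Hbd Hx Hx').
    pose proof (lipschitz_of_derivative_bound f f' D _ _ Hf Hbd Itau Htau').
    replace ((f x' - f tau') - (f x - f tau))
      with ((f x' - f x) + - (f tau' - f tau)) by ring.
    eapply Rle_trans; [apply Rabs_triang |]; rewrite Rabs_Ropp; nra. }
  set (q := (f x' - f tau') / (x' - tau')).
  assert (Hq : Rabs q <= D).
  { unfold q; rewrite Rabs_div by exact Hd0'.
    apply Rle_div_l; [apply Rabs_pos_lt; exact Hd0' |].
    exact (lipschitz_of_derivative_bound f f' D _ _ Hf Hbd Htau' Hx'). }
  pose proof (quotient_perturbation _ _ _ _ D (2 * eps) Hd0 Hd0' HN Hdd Hq)
    as Hargs.
  fold q in Hargs.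
  destruct (relative_rounding_error (Rabs K) eps q g3 HK He Hs Hg3)
    as [H3 Hround].
  replace ((f x' - f tau') / ((x' - tau') * (1 + g3))) with (q / (1 + g3))
    by (unfold q; field; split; assumption).
  set (p := (f x - f tau) / (x - tau)) in *.
  set (B := 4 * eps * D / Rabs (x - tau)).
  assert (HB : 2 * eps * D <= B).
  { apply (Rle_div_r _ _ (Rabs (x - tau))); [lra |].
    assert (0 <= 2 * eps * D) by (repeat apply Rmult_le_pos; lra); nra. }
  assert (HB0 : 0 <= B)
    by (apply Rle_trans with (2 := HB); repeat apply Rmult_le_pos; lra).
  replace (2 * (2 * eps) * D / Rabs (x - tau)) with B in Hargs
    by (unfold B; field; lra).
  replace (8 * eps * D / Rabs (x - tau)) with (2 * B)
    by (unfold B; field; lra).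
  assert (HC : 0 <= (Rabs K + 6) * eps) by (apply Rmult_le_pos; lra).
  apply le_lesssim; [lra | exact He | apply Rabs_pos | lra |].
  replace (q / (1 + g3) - p) with ((q / (1 + g3) - q) + (q - p)) by ring.
  eapply Rle_trans; [apply Rabs_triang |].
  set (w := 1 + (Rabs K + 6) * eps) in *.
  assert (Rabs q * (2 * eps * w) <= B * w).
  { apply Rle_trans with (D * (2 * eps * w)).
    - apply Rmult_le_compat_r; [| exact Hq].
      repeat apply Rmult_le_pos; unfold w; lra.
    - replace (D * (2 * eps * w)) with (2 * eps * D * w) by ring.
      apply Rmult_le_compat_r; [unfold w; lra | exact HB]. }
  assert (B <= B * w) by (unfold w; nra).
  lra.
Qed.
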